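(* Let $\mathcal{I}$ be a proper admissible ideal on $\mathbb{N}$. If $X$ is a countable $\mathcal{I}$-H-separable Tychonoff space and $Y$ is a countable Tychonoff space with $\pi w(Y) < \mathfrak{b}$, then $X\times Y$ is $\mathcal{I}$-H-separable.
   Context: An ideal on $\mathbb{N}$ is a family of subsets of $\mathbb{N}$ closed under finite unions and under subsets; it is admissible if it contains every singleton and proper if it does not contain $\mathbb{N}$. A space $X$ is $\mathcal{I}$-H-separable if for every sequence $(Y_n)_{n\in\mathbb{N}}$ of dense subspaces of $X$ there is a sequence $(F_n)_{n\in\mathbb{N}}$ such that each $F_n$ is a finite subset of $Y_n$ and for every nonempty open set $U$ of $X$, $\{n\in\mathbb{N} : U\cap F_n=\emptyset\}\in\mathcal{I}$. A $\pi$-base of a space is a collection $\mathcal{B}$ of open sets such that every nonempty open set contains a nonempty member of $\mathcal{B}$; the $\pi$-weight $\pi w(Y)$ is the least cardinality of a $\pi$-base of $Y$. $\mathfrak{b}$ is the bounding number, i.e. the least cardinality of a subset of $\mathbb{N}^{\mathbb{N}}$ that is unbounded with respect to $\leq^*$, where $f\leq^* g$ means $f(n)\leq g(n)$ for all but finitely many $n$. *)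

(* Defs.v *)
From HB Require Import structures.
From mathcomp Require Import all_boot all_order all_algebra.
From mathcomp Require Import all_classical all_reals all_analysis.

Set Implicit Arguments.
Unset Strict Implicit.
Unset Printing Implicit Defensive.

Local Open Scope classical_set_scope.
Local Open Scope card_scope.

(* The empty set is the union of the empty finite subfamily. *)
Definition nat_ideal (I : set (set nat)) : Prop :=
  [/\ I set0,
      forall A B, I A -> I B -> I (A `|` B)
    & forall A B, B `<=` A -> I A -> I B].

Definition admissible_nat_ideal (I : set (set nat)) : Prop :=
  nat_ideal I /\ forall n, I [set n].

Definition proper_nat_ideal (I : set (set nat)) : Prop :=
  nat_ideal I /\ ~ I setT.

Definition tychonoff_space (T : topologicalType) : Prop :=
  completely_regular_space T /\ accessible_space T.

Definition IH_separable (I : set (set nat)) (X : topologicalType) : Prop :=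
  forall D : nat -> set X, (forall n, dense (D n)) ->
  exists F : nat -> set X,
    (forall n, finite_set (F n) /\ F n `<=` D n) /\
    forall U : set X, open U -> U !=set0 -> I [set n | U `&` F n = set0].

Definition card_lt (T U : Type) (A : set T) (B : set U) : Prop :=
  A #<= B /\ ~ (B #<= A).

(* A cardinal is represented by a set of that cardinality: [min_card P] is a
   chosen member of P of least cardinality (it exists by [min_cardP]). *)
Definition min_card (T : Type) (P : set (set T)) : set T :=
  xget set0 [set A | P A /\ forall B, P B -> A #<= B].

Definition pi_base (T : topologicalType) (B : set (set T)) : Prop :=
  B `<=` open /\
  forall U : set T, open U -> U !=set0 ->
    exists V : set T, [/\ B V, V !=set0 & V `<=` U].

Definition pi_weight (T : topologicalType) : set (set T) :=
  min_card (@pi_base T).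
Arguments pi_weight : clear implicits.

Definition le_star (f g : nat -> nat) : Prop :=
  finite_set [set n | ~ (f n <= g n)%N].

Definition unbounded_star (F : set (nat -> nat)) : Prop :=
  ~ exists g, forall f, F f -> le_star f g.

Definition bounding_number : set (nat -> nat) := min_card unbounded_star.

Lemma min_cardP (T : Type) (P : set (set T)) : P !=set0 ->
  P (min_card P) /\ forall B, P B -> min_card P #<= B.
Proof.
move=> P0.
suff: exists A, [set A | P A /\ forall B, P B -> A #<= B] A by exact: xgetPex.
(* A maximal set S of choice functions for P that is injective at each member
   of P evaluates onto some member of P, which then embeds in all the others. *)
pose good (S : set (set T -> T)) :=
  (forall f B, S f -> P B -> B (f B)) /\
  (forall f g B, S f -> S g -> P B -> f B = g B -> f = g).
have [|S [[Sin Sinj] Smax]] := @Zorn_bigcup _ good.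
  move=> F Fgood totF; split.
    by move=> f B [S FS Sf] PB; have [h _] := Fgood _ FS; exact: h Sf PB.
  move=> f g B [S FS Sf] [S' FS' Sg] PB.
  have [SS'|S'S] := totF _ _ FS FS'.
    by have [_ h] := Fgood _ FS'; apply: h PB => //; exact: SS'.
  by have [_ h] := Fgood _ FS; apply: h PB => //; exact: S'S.
have [[A [PA AS]]|nA] :=
    pselect (exists A, P A /\ A `<=` (fun f => f A) @` S).
  exists A; split => // B PB.
  apply: (card_le_trans (subset_card_le AS)).
  apply: (card_le_trans (card_image_le _ _)).
  suff /injfunPex[h] : exists2 h : (set T -> T) -> T,
    set_fun S B h & set_inj S h by exact: inj_card_le h.
  exists (fun f : set T -> T => f B); first by move=> f /= Sf; exact: Sin Sf PB.
  by move=> f g; rewrite !inE => Sf Sg; exact: Sinj Sf Sg PB.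
exfalso.
have new B : P B -> exists x, B x /\ ~ ((fun f => f B) @` S) x.
  move=> PB; apply: contrapT => h; apply: nA; exists B; split => // x Bx.
  by apply: contrapT => nx; apply: h; exists x.
have [B0 PB0] := P0; have [x0 _] := new _ PB0.
have [f fP] : exists f : set T -> T,
    forall B, P B -> B (f B) /\ ~ ((fun f => f B) @` S) (f B).
  suff /boolp.choice[f fP] : forall B, exists x,
      P B -> B x /\ ~ ((fun f => f B) @` S) x by exists f.
  move=> B; have [/new[x xP]|nPB] := pselect (P B); first by exists x.
  by exists x0.
have nSf : ~ S f.
  by move=> Sf; have [_] := fP _ PB0; apply; exists f.
apply: (Smax (S `|` [set f])).
  split; last by move=> /(_ f (or_intror erefl)).
  by move=> g; left.
split.
  by move=> g B [Sg|->] PB; [exact: Sin Sg PB|have [] := fP _ PB].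
move=> g h B [Sg|->] [Sh|->] PB //; first exact: Sinj Sg Sh PB.
- by move=> e; have [_] := fP _ PB; case; exists g.
- by move=> e; have [_] := fP _ PB; case; exists h.
Qed.

Lemma pi_weightP (T : topologicalType) :
  pi_base (pi_weight T) /\
  forall B : set (set T), pi_base B -> pi_weight T #<= B.
Proof.
apply: min_cardP; exists open; split=> [U//|U oU U0].
by exists U; split.
Qed.

Lemma bounding_numberP :
  unbounded_star bounding_number /\
  forall F, unbounded_star F -> bounding_number #<= F.
Proof.
apply: min_cardP; exists setT => -[g /(_ (fun n => (g n).+1) I)].
rewrite /le_star (_ : [set n | _] = setT); first exact: infinite_nat.
by apply/seteqP; split => // n _ /=; rewrite ltnn.
Qed.

(* Main.v *)
Require Import Defs.
From mathcomp Require Import all_boot all_order all_algebra.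
From mathcomp Require Import all_classical all_reals all_analysis.

(** Let D_n be dense in X * Y.  For a nonempty open set V of Y, the traces on X
    of the sets D_n `&` (X * V) are dense, so I-H-separability of X selects
    finitely many points of each trace that meet every nonempty open U outside
    a set of I.  Lifting these points back to D_n and recording the largest
    index they have in a fixed enumeration of the countable space X * Y turns
    the selection for V into a function f_V : nat -> nat
    ([dense_strip_selection]).  When V runs over a pi-base of Y of cardinality
    below the bounding number, a single g dominates all the f_V modulo finite
    sets ([card_lt_bounding_number]).  The points of D_n of index at most g n
    are finitely many, and they contain the selection for V for almost every n.
    Every nonempty open set of X * Y contains some U * V with V in the pi-base,
    and an admissible ideal ignores the finitely many exceptional n
    ([admissible_finite]); hence these sets witness I-H-separability. *)

Set Implicit Arguments.
Unset Strict Implicit.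
Unset Printing Implicit Defensive.

Local Open Scope classical_set_scope.
Local Open Scope card_scope.

Lemma finite_image_bounded (T : Type) (A : set T) (h : T -> nat) :
  finite_set A -> exists N, forall x, A x -> (h x <= N)%N.
Proof.
move=> /(finite_image h)/finite_seqP[s hAs].
exists (\max_(k <- s) k) => x Ax.
have hxs : h x \in s by have : [set` s] (h x) by rewrite -hAs; exists x.
by rewrite (big_rem _ hxs) /= leq_maxl.
Qed.

Lemma admissible_finite (I : set (set nat)) (A : set nat) :
  admissible_nat_ideal I -> finite_set A -> I A.
Proof.
move=> [[I0 IU Isub] I1] /finite_seqP[s ->].
elim: s => [|n s IHs]; first by rewrite set_nil.
apply: Isub (IU _ _ (I1 n) IHs) => k /=.
by rewrite in_cons => /orP[/eqP|]; [left|right].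
Qed.

Lemma open_prod_rectangle (X Y : topologicalType) (W : set (X * Y)) :
  open W -> W !=set0 ->
  exists U V, [/\ open U, open V, U !=set0, V !=set0 & U `*` V `<=` W].
Proof.
move=> oW [[x y] Wxy].
have [[A B] /= [nA nB] AB] : nbhs (x, y) W by exact: open_nbhs_nbhs.
exists A°, B°; split; [exact: open_interior|exact: open_interior| | |].
- by exists x.
- by exists y.
- by move=> p [Ap Bp]; apply: AB; split; exact: interior_subset.
Qed.

Lemma open_rectangle (X Y : topologicalType) (U : set X) (V : set Y) :
  open U -> open V -> open (U `*` V).
Proof.
move=> oU oV; rewrite openE => -[x y] [/= Ux Vy].
by exists (U, V) => //=; split; exact: open_nbhs_nbhs.
Qed.

Lemma dense_strip_projection (X Y : topologicalType) (D : set (X * Y))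
    (V : set Y) : dense D -> open V -> V !=set0 ->
  dense [set x | exists2 y, D (x, y) & V y].
Proof.
move=> dD oV [y0 Vy0] U [x0 Ux0] oU.
have [|[x y] [[Ux Vy] Dxy]] := dD (U `*` V) _ (open_rectangle oU oV).
  by exists (x0, y0).
by exists x; split=> //; exists y.
Qed.

(** The selection inside the strip X * V, encoded by one function: bounding the
    indices h is all that is kept of the finite sets, so that selections for
    different V can be compared by domination. *)
Lemma dense_strip_selection (I : set (set nat)) (X Y : topologicalType)
    (D : nat -> set (X * Y)) (V : set Y) (h : X * Y -> nat) :
  nat_ideal I -> IH_separable I X -> (forall n, dense (D n)) ->
  open V -> V !=set0 ->
  exists f : nat -> nat, forall U, open U -> U !=set0 ->
    I [set n | ~ exists2 p, (D n `&` (U `*` V)) p & (h p <= f n)%N].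
Proof.
move=> [_ _ Isub] sepX dD oV V0.
have [F [FD FU]] := sepX _ (fun n => dense_strip_projection (dD n) oV V0).
have /boolp.choice[f fP] n : exists N, forall x, F n x ->
    exists y, [/\ D n (x, y), V y & (h (x, y) <= N)%N].
  have [finF subF] := FD n; have [y0 _] := V0.
  have /boolp.choice[s sP] x : exists y, F n x -> D n (x, y) /\ V y.
    have [/subF[y Dxy Vy]|nFx] := pselect (F n x); first by exists y.
    by exists y0.
  have [N hN] := finite_image_bounded (fun x => h (x, s x)) finF.
  by exists N => x Fx; have [Dx Vx] := sP _ Fx; exists (s x); split=> //; exact: hN.
exists f => U oU U0; apply: Isub (FU _ oU U0) => n /= nDn.
apply/seteqP; split=> // x [Ux /fP[y [Dxy Vy hxy]]].
by apply: nDn; exists (x, y).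
Qed.

(** The bounding number embeds in every unbounded family, and the image of B
    under f is too small for that; indexing by B spares any injectivity of f. *)
Lemma card_lt_bounding_number (T : Type) (B : set T) (f : T -> nat -> nat) :
  card_lt B bounding_number ->
  exists g, forall x, B x -> le_star (f x) g.
Proof.
move=> [_ nbB]; apply: contrapT => nbound; apply: nbB.
have [_ bmin] := bounding_numberP.
apply: card_le_trans (card_image_le f B); apply: bmin => -[g gP].
by apply: nbound; exists g => x Bx; apply: gP; exists x.
Qed.

Theorem theorem3p11 (I : set (set nat)) (X Y : topologicalType)
    (properI : proper_nat_ideal I) (admissibleI : admissible_nat_ideal I)
    (countableX : countable [set: X]) (tychonoffX : tychonoff_space X)
    (sepX : IH_separable I X)
    (countableY : countable [set: Y]) (tychonoffY : tychonoff_space Y)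
    (piwY : card_lt (pi_weight Y) bounding_number) :
  IH_separable I (X * Y)%type.
Proof.
move=> D dD.
have [idI _] := admissibleI; have [_ IU Isub] := idI.
have [[piO piP] _] := pi_weightP Y.
have /countable_injP[h hinj] : countable [set: X * Y].
  by rewrite -setXTT; exact: cardinality.countableX.
have /boolp.choice[f fP] V : exists f : nat -> nat,
    pi_weight Y V -> V !=set0 -> forall U, open U -> U !=set0 ->
    I [set n | ~ exists2 p, (D n `&` (U `*` V)) p & (h p <= f n)%N].
  have [[piV V0]|nV] := pselect (pi_weight Y V /\ V !=set0).
    have [f fV] := dense_strip_selection h idI sepX dD (piO _ piV) V0.
    by exists f.
  by exists id => piV V0; case: nV.
have [g gP] := card_lt_bounding_number f piwY.
exists (fun n => D n `&` [set p | (h p <= g n)%N]); split=> [n|W oW W0].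
  split=> [|p []//]; apply: finite_setIr.
  apply: (@finite_preimage _ _ [set k | (k <= g n)%N]).
    by move=> p q _ _; apply: hinj; rewrite inE.
  by apply: sub_finite_set (finite_II (g n).+1) => k /=; rewrite ltnS.
have [U [V' [oU oV' U0 V'0 UV'W]]] := open_prod_rectangle oW W0.
have [V [piV V0 VV']] := piP _ oV' V'0.
apply: Isub (IU _ _ (fP _ piV V0 _ oU U0)
  (admissible_finite admissibleI (gP _ piV))) => n /= Wn.
have [fg|] := pselect (f V n <= g n)%N; last by right.
left=> -[[x y] [Dp [Ux Vy]] hp].
suff : set0 (x, y) by [].
rewrite -Wn; split; first by apply: UV'W; split=> //; exact: VV'.
by split=> //=; exact: leq_trans hp fg.
Qed.
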